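(* Let $S_5\subseteq(\mathbb C^2)^{\otimes3}$ (three parties, one qubit each) be the 5-dimensional span of $|000\rangle$, $|001\rangle-|100\rangle$, $|110\rangle-|011\rangle$, $|001\rangle+|010\rangle+|100\rangle$, $|110\rangle+|101\rangle+|011\rangle$. Then $S_5$ is locally indistinguishable: no orthonormal basis of $S_5$ is perfectly distinguishable by LOCC.
   Context: ''Perfectly distinguishable by LOCC'': there is a finite-round protocol, in each round one party performing a local measurement and broadcasting the outcome, that identifies with probability 1 which state of the set was given. *)

(* Defs.v *)
(* Scalars: an arbitrary numClosedFieldType C (the complex
   numbers are such a field). *)
From HB Require Import structures.
From mathcomp Require Import all_boot all_order all_algebra.
Set Implicit Arguments. Unset Strict Implicit. Unset Printing Implicit Defensive.
Import Order.TTheory GRing.Theory Num.Theory.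
Local Open Scope ring_scope.

(* A (unnormalised) vector of C^d0 (x) C^d1 (x) C^d2, as a 3-index tensor;
   index k belongs to party k. *)
Definition tensor (C : Type) (d0 d1 d2 : nat) :=
  'I_d0 -> 'I_d1 -> 'I_d2 -> C.

(* conjugate transpose *)
Definition adj (C : numClosedFieldType) m n (A : 'M[C]_(m, n)) : 'M[C]_(n, m) :=
  (map_mx (fun x => x^*) A)^T.

(* Finite LOCC protocol tree. At a node, one party applies a local quantum
   instrument given by Kraus operators K j (one per broadcast outcome j);
   the output local dimension m may differ from the input one (ancillas,
   discarding). At a leaf the protocol announces its guess. *)
Inductive locc (C : Type) : nat -> nat -> nat -> Type :=
| Guess (d0 d1 d2 : nat) (g : nat) : locc C d0 d1 d2
| Meas0 (d0 d1 d2 m n : nat) (K : 'I_n -> 'M[C]_(m, d0))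
    (next : 'I_n -> locc C m d1 d2) : locc C d0 d1 d2
| Meas1 (d0 d1 d2 m n : nat) (K : 'I_n -> 'M[C]_(m, d1))
    (next : 'I_n -> locc C d0 m d2) : locc C d0 d1 d2
| Meas2 (d0 d1 d2 m n : nat) (K : 'I_n -> 'M[C]_(m, d2))
    (next : 'I_n -> locc C d0 d1 m) : locc C d0 d1 d2.

(* validity: every instrument is trace preserving, sum_j K_j^dag K_j = 1 *)
Fixpoint valid (C : numClosedFieldType) d0 d1 d2 (P : locc C d0 d1 d2) : Prop :=
  match P with
  | Guess _ _ _ _ => True
  | Meas0 _ _ _ _ n K next =>
      \sum_(j < n) adj (K j) *m K j = 1%:M /\ forall j, valid (next j)
  | Meas1 _ _ _ _ n K next =>
      \sum_(j < n) adj (K j) *m K j = 1%:M /\ forall j, valid (next j)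
  | Meas2 _ _ _ _ n K next =>
      \sum_(j < n) adj (K j) *m K j = 1%:M /\ forall j, valid (next j)
  end.

Definition app0 (C : numClosedFieldType) d0 d1 d2 m (K : 'M[C]_(m, d0))
  (psi : tensor C d0 d1 d2) : tensor C m d1 d2 :=
  fun a b c => \sum_(a0 < d0) K a a0 * psi a0 b c.
Definition app1 (C : numClosedFieldType) d0 d1 d2 m (K : 'M[C]_(m, d1))
  (psi : tensor C d0 d1 d2) : tensor C d0 m d2 :=
  fun a b c => \sum_(b0 < d1) K b b0 * psi a b0 c.
Definition app2 (C : numClosedFieldType) d0 d1 d2 m (K : 'M[C]_(m, d2))
  (psi : tensor C d0 d1 d2) : tensor C d0 d1 m :=
  fun a b c => \sum_(c0 < d2) K c c0 * psi a b c0.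

(* [correct P psi i]: run on the (unnormalised) state psi, every leaf that is
   reached with nonzero probability (nonzero post-measurement vector) guesses
   i; i.e. P identifies i with probability 1. *)
Fixpoint correct (C : numClosedFieldType) d0 d1 d2 (P : locc C d0 d1 d2)
  : tensor C d0 d1 d2 -> nat -> Prop :=
  match P in locc _ e0 e1 e2 return tensor C e0 e1 e2 -> nat -> Prop with
  | Guess _ _ _ g => fun psi i => (forall a b c, psi a b c = 0) \/ g = i
  | Meas0 _ _ _ _ _ K next => fun psi i =>
      forall j, correct (next j) (app0 (K j) psi) i
  | Meas1 _ _ _ _ _ K next => fun psi i =>
      forall j, correct (next j) (app1 (K j) psi) i
  | Meas2 _ _ _ _ _ K next => fun psi i =>
      forall j, correct (next j) (app2 (K j) psi) i
  end.

(* A family of states is perfectly distinguishable by LOCC. *)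
Definition locc_perfectly_distinguishable (C : numClosedFieldType) d0 d1 d2 k
  (phi : 'I_k -> tensor C d0 d1 d2) : Prop :=
  exists P : locc C d0 d1 d2, valid P /\ forall i : 'I_k, correct P (phi i) i.

(* three-qubit computational basis vector |x y z> *)
Definition ket (C : numClosedFieldType) (x y z : nat) : tensor C 2 2 2 :=
  fun a b c => if [&& nat_of_ord a == x, nat_of_ord b == y & nat_of_ord c == z]
               then 1 else 0.

(* the five spanning vectors of S_5 *)
Definition gen5 (C : numClosedFieldType) (l : 'I_5) : tensor C 2 2 2 :=
  fun a b c =>
  match nat_of_ord l with
  | 0 => ket C 0 0 0 a b c
  | 1 => ket C 0 0 1 a b c - ket C 1 0 0 a b c
  | 2 => ket C 1 1 0 a b c - ket C 0 1 1 a b c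
  | 3 => ket C 0 0 1 a b c + ket C 0 1 0 a b c + ket C 1 0 0 a b c
  | _ => ket C 1 1 0 a b c + ket C 1 0 1 a b c + ket C 0 1 1 a b c
  end.

Definition inS5 (C : numClosedFieldType) (v : tensor C 2 2 2) : Prop :=
  exists w : 'I_5 -> C, forall a b c, v a b c = \sum_(l < 5) w l * gen5 C l a b c.

Definition inner (C : numClosedFieldType) d0 d1 d2 (u v : tensor C d0 d1 d2) : C :=
  \sum_(a < d0) \sum_(b < d1) \sum_(c < d2) (u a b c)^* * v a b c.

(* phi is an orthonormal basis of S_5: elements lie in S_5, are orthonormal,
   and span S_5. *)
Definition onb_S5 (C : numClosedFieldType) (phi : 'I_5 -> tensor C 2 2 2) : Prop :=
  [/\ forall i, inS5 (phi i),
      forall i j, inner (phi i) (phi j) = (i == j)%:R &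
      forall l, exists w : 'I_5 -> C,
        forall a b c, gen5 C l a b c = \sum_(i < 5) w i * phi i a b c].

(* Main.v *)
(* Every LOCC protocol refines to a separable measurement: product vectors x_l
   with sum_l |x_l><x_l| = 1, where x_l is orthogonal to every state that the
   protocol identifies with an index other than the guess of l.  For an
   orthonormal basis phi of S_5 this gives
     phi_i = sum_l <x_l|phi_i> x_l,
   and whenever <x_l|phi_i> <> 0 the projection of x_l on S_5 is a multiple of
   phi_i.  Suppose phi_i is not orthogonal to |001> - |100>.  A product vector
   that is not orthogonal to |001> - |100> is determined by its projection on
   S_5, because |001> - |100> and |011> - |110> give the ratio of the two
   coordinates of the middle factor, after which everything is linear.  So all
   those x_l are multiples of phi_i, and phi_i is a product vector; but the only
   product vector in S_5 is |000>, up to scaling.  Hence all phi_i are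
   orthogonal to |001> - |100>, which lies in their span: a contradiction. *)
Require Import Defs.
From HB Require Import structures.
From mathcomp Require Import all_boot all_order all_algebra.
From mathcomp Require Import ring.
Set Implicit Arguments. Unset Strict Implicit. Unset Printing Implicit Defensive.
Import Order.TTheory GRing.Theory Num.Theory.
Local Open Scope ring_scope.

(** * Inner products, adjoints of local operators, and Kraus completeness *)

Section Inner.
Variable C : numClosedFieldType.

Lemma inner_conj d0 d1 d2 (u v : tensor C d0 d1 d2) :
  inner u v = (inner v u)^*.
Proof.
rewrite /inner rmorph_sum; apply: eq_bigr => a _.
rewrite rmorph_sum; apply: eq_bigr => b _.
rewrite rmorph_sum; apply: eq_bigr => c _.
by rewrite rmorphM /= conjCK mulrC.
Qed.

Lemma inner_sumr d0 d1 d2 k (u v : tensor C d0 d1 d2) (w : 'I_k -> C)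
    (phi : 'I_k -> tensor C d0 d1 d2) :
  (forall a b c, v a b c = \sum_(i < k) w i * phi i a b c) ->
  inner u v = \sum_(i < k) w i * inner u (phi i).
Proof.
move=> Ev; rewrite /inner.
under [RHS]eq_bigr do rewrite mulr_sumr.
rewrite [RHS]exchange_big; apply: eq_bigr => a _ /=.
under [RHS]eq_bigr do rewrite mulr_sumr.
rewrite [RHS]exchange_big; apply: eq_bigr => b _ /=.
under [RHS]eq_bigr do rewrite mulr_sumr.
rewrite [RHS]exchange_big; apply: eq_bigr => c _ /=.
by rewrite Ev mulr_sumr; apply: eq_bigr => i _; rewrite mulrCA.
Qed.

Lemma inner_app0 d0 d1 d2 m (K : 'M[C]_(m, d0)) (u : tensor C m d1 d2)
    (v : tensor C d0 d1 d2) :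
  inner (app0 (adj K) u) v = inner u (app0 K v).
Proof.
rewrite /inner exchange_big [RHS]exchange_big; apply: eq_bigr => b _ /=.
rewrite exchange_big [RHS]exchange_big; apply: eq_bigr => c _ /=.
under eq_bigr do rewrite rmorph_sum mulr_suml.
under [RHS]eq_bigr do rewrite mulr_sumr.
rewrite exchange_big; apply: eq_bigr => a _; apply: eq_bigr => a0 _.
by rewrite rmorphM !mxE /= conjCK mulrCA mulrA.
Qed.

Lemma inner_app1 d0 d1 d2 m (K : 'M[C]_(m, d1)) (u : tensor C d0 m d2)
    (v : tensor C d0 d1 d2) :
  inner (app1 (adj K) u) v = inner u (app1 K v).
Proof.
rewrite /inner; apply: eq_bigr => a _ /=.
rewrite exchange_big [RHS]exchange_big; apply: eq_bigr => c _ /=.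
under eq_bigr do rewrite rmorph_sum mulr_suml.
under [RHS]eq_bigr do rewrite mulr_sumr.
rewrite exchange_big; apply: eq_bigr => b _; apply: eq_bigr => b0 _.
by rewrite rmorphM !mxE /= conjCK mulrCA mulrA.
Qed.

Lemma inner_app2 d0 d1 d2 m (K : 'M[C]_(m, d2)) (u : tensor C d0 d1 m)
    (v : tensor C d0 d1 d2) :
  inner (app2 (adj K) u) v = inner u (app2 K v).
Proof.
rewrite /inner; apply: eq_bigr => a _ /=; apply: eq_bigr => b _ /=.
under eq_bigr do rewrite rmorph_sum mulr_suml.
under [RHS]eq_bigr do rewrite mulr_sumr.
rewrite exchange_big; apply: eq_bigr => c _; apply: eq_bigr => c0 _.
by rewrite rmorphM !mxE /= conjCK mulrCA mulrA.
Qed.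

Lemma inner_eql d0 d1 d2 (u u' v : tensor C d0 d1 d2) :
  (forall a b c, u a b c = u' a b c) -> inner u v = inner u' v.
Proof.
move=> Eu; apply: eq_bigr => a _; apply: eq_bigr => b _.
by apply: eq_bigr => c _; rewrite Eu.
Qed.

(** Trace preservation in coordinates; [f] stands for a fibre of the state along the measured party,
    so one lemma serves all three kinds of node. *)
Lemma kraus_resolution d m n (K : 'I_n -> 'M[C]_(m, d)) (f : 'I_d -> C) a :
  \sum_(j < n) adj (K j) *m K j = 1%:M ->
  \sum_(j < n) \sum_(p < m) adj (K j) a p * (\sum_(q < d) K j p q * f q) = f a.
Proof.
move=> KE.
transitivity (\sum_(q < d) (1%:M : 'M[C]_d) a q * f q); last first.
  rewrite (bigD1 a) //= mxE eqxx mul1r big1 ?addr0 // => q /negPf.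
  by rewrite mxE eq_sym => ->; rewrite mul0r.
rewrite -KE; under [RHS]eq_bigr do rewrite summxE mulr_suml.
rewrite [RHS]exchange_big; apply: eq_bigr => j _ /=.
under eq_bigr do rewrite mulr_sumr.
rewrite exchange_big; apply: eq_bigr => q _ /=.
by rewrite mxE mulr_suml; apply: eq_bigr => p _; rewrite mulrA.
Qed.

End Inner.

(** * Refinement of an LOCC protocol to a product measurement *)

Section ProductMeasurement.
Variable C : numClosedFieldType.

Record product_measurement (d0 d1 d2 : nat) := ProductMeasurement {
  outcome : finType;
  outcome_guess : outcome -> nat;
  factor0 : outcome -> 'cV[C]_d0;
  factor1 : outcome -> 'cV[C]_d1;
  factor2 : outcome -> 'cV[C]_d2 }.

Definition outcome_vec d0 d1 d2 (M : product_measurement d0 d1 d2)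
  (l : outcome M) : tensor C d0 d1 d2 :=
  fun a b c => factor0 l a 0 * factor1 l b 0 * factor2 l c 0.

(** A leaf has the identity as its effect; the computational basis splits it into rank-one product
    effects that keep the same guess. *)
Definition basis_measurement d0 d1 d2 (g : nat) : product_measurement d0 d1 d2 :=
  @ProductMeasurement d0 d1 d2 ('I_d0 * 'I_d1 * 'I_d2)%type (fun=> g)
    (fun l => delta_mx l.1.1 0) (fun l => delta_mx l.1.2 0)
    (fun l => delta_mx l.2 0).

(** Outcome vectors are pulled back from the leaves by <x|K psi> = <K^dag x|psi>; the adjoint acts
    on the factor of the measuring party only, so products stay products. *)
Fixpoint locc_measurement d0 d1 d2 (P : locc C d0 d1 d2) :
    product_measurement d0 d1 d2 :=
  match P with
  | Guess d0 d1 d2 g => basis_measurement d0 d1 d2 g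
  | Meas0 d0 d1 d2 m n K next =>
      let M j := locc_measurement (next j) in
      @ProductMeasurement d0 d1 d2 {j : 'I_n & outcome (M j)}
        (fun l => outcome_guess (tagged l))
        (fun l => adj (K (tag l)) *m factor0 (tagged l))
        (fun l => factor1 (tagged l)) (fun l => factor2 (tagged l))
  | Meas1 d0 d1 d2 m n K next =>
      let M j := locc_measurement (next j) in
      @ProductMeasurement d0 d1 d2 {j : 'I_n & outcome (M j)}
        (fun l => outcome_guess (tagged l))
        (fun l => factor0 (tagged l))
        (fun l => adj (K (tag l)) *m factor1 (tagged l))
        (fun l => factor2 (tagged l))
  | Meas2 d0 d1 d2 m n K next =>
      let M j := locc_measurement (next j) in
      @ProductMeasurement d0 d1 d2 {j : 'I_n & outcome (M j)}
        (fun l => outcome_guess (tagged l))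
        (fun l => factor0 (tagged l)) (fun l => factor1 (tagged l))
        (fun l => adj (K (tag l)) *m factor2 (tagged l))
  end.

Lemma outcome_vec_Meas0 d0 d1 d2 m n (K : 'I_n -> 'M[C]_(m, d0))
    (next : 'I_n -> locc C m d1 d2) j (l : outcome (locc_measurement (next j)))
    a b c :
  @outcome_vec _ _ _ (locc_measurement (Meas0 K next)) (existT _ j l) a b c =
  app0 (adj (K j)) (outcome_vec l) a b c.
Proof.
rewrite /outcome_vec /app0 /= mxE !mulr_suml.
by apply: eq_bigr => p _; rewrite !mulrA.
Qed.

Lemma outcome_vec_Meas1 d0 d1 d2 m n (K : 'I_n -> 'M[C]_(m, d1))
    (next : 'I_n -> locc C d0 m d2) j (l : outcome (locc_measurement (next j)))
    a b c :
  @outcome_vec _ _ _ (locc_measurement (Meas1 K next)) (existT _ j l) a b c =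
  app1 (adj (K j)) (outcome_vec l) a b c.
Proof.
rewrite /outcome_vec /app1 /= mxE mulr_sumr mulr_suml.
by apply: eq_bigr => p _; rewrite !mulrA [_ * adj _ _ _]mulrC.
Qed.

Lemma outcome_vec_Meas2 d0 d1 d2 m n (K : 'I_n -> 'M[C]_(m, d2))
    (next : 'I_n -> locc C d0 d1 m) j (l : outcome (locc_measurement (next j)))
    a b c :
  @outcome_vec _ _ _ (locc_measurement (Meas2 K next)) (existT _ j l) a b c =
  app2 (adj (K j)) (outcome_vec l) a b c.
Proof.
rewrite /outcome_vec /app2 /= mxE mulr_sumr.
by apply: eq_bigr => p _; rewrite mulrCA.
Qed.

Lemma basis_measurement_inner d0 d1 d2 g (psi : tensor C d0 d1 d2) a b c :
  inner (@outcome_vec _ _ _ (basis_measurement d0 d1 d2 g) (a, b, c)) psi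
  = psi a b c.
Proof.
rewrite /inner (bigD1 a) //= (bigD1 b) //= (bigD1 c) //=.
rewrite /outcome_vec /= !mxE !eqxx !mul1r rmorph1 mul1r.
rewrite !big1 ?addr0 // => [a' /negPf Na|b' /negPf Nb|c' /negPf Nc].
- rewrite big1 // => b' _; rewrite big1 // => c' _.
  by rewrite !mxE Na !mul0r rmorph0 mul0r.
- by rewrite big1 // => c' _; rewrite !mxE Nb mulr0 !mul0r rmorph0 mul0r.
- by rewrite !mxE Nc mulr0 rmorph0 mul0r.
Qed.

Lemma sum_tagged n (J : 'I_n -> finType) (G : {j : 'I_n & J j} -> C)
    (F : forall j, J j -> C) :
  (forall j l, G (existT _ j l) = F j l) ->
  \sum_l G l = \sum_(j < n) \sum_l F j l.
Proof.
move=> GF; rewrite (sig_big_dep xpredT (fun=> xpredT) F) /=.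
by apply: eq_bigr => -[j l] _.
Qed.

(** Induction on the tree: [kraus_resolution] writes psi as the sum of K_j^dag K_j psi, the
    induction hypothesis expands K_j psi, and K_j^dag passes onto the outcome vectors. *)
Lemma locc_measurement_resolution d0 d1 d2 (P : locc C d0 d1 d2) :
  valid P -> forall psi a b c,
  psi a b c = \sum_(l : outcome (locc_measurement P))
                 outcome_vec l a b c * inner (outcome_vec l) psi.
Proof.
elim: P => {d0 d1 d2} [d0 d1 d2 g|d0 d1 d2 m n K next IH|d0 d1 d2 m n K next IH
  |d0 d1 d2 m n K next IH] /=.
- move=> _ psi a b c; rewrite (bigD1 (a, b, c)) //=.
  rewrite basis_measurement_inner big1 => [|[[a' b'] c'] Nabc].
    by rewrite /outcome_vec /= !mxE !eqxx !mul1r addr0.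
  suff -> : @outcome_vec _ _ _ (basis_measurement d0 d1 d2 g) (a', b', c') a b c = 0
    by rewrite mul0r.
  apply/eqP; apply: contraNT Nabc; rewrite /outcome_vec /= !mxE !andbT.
  case: (a =P a') => [->|_]; last by rewrite !mul0r eqxx.
  case: (b =P b') => [->|_]; last by rewrite mulr0 mul0r eqxx.
  by case: (c =P c') => [->|_]; rewrite ?mulr0 eqxx.
- case=> KE vnext psi a b c.
  rewrite -[LHS](kraus_resolution (fun q => psi q b c) a KE).
  rewrite (@sum_tagged _ _ _ (fun j l =>
    app0 (adj (K j)) (outcome_vec l) a b c *
    inner (outcome_vec l) (app0 (K j) psi))) => [|j l]; last first.
    rewrite outcome_vec_Meas0.
    by rewrite (inner_eql _ (@outcome_vec_Meas0 _ _ _ _ _ K next j l)) inner_app0.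
  apply: eq_bigr => j _.
  under [RHS]eq_bigr do rewrite mulr_suml.
  rewrite [RHS]exchange_big; apply: eq_bigr => p _ /=.
  rewrite -[\sum_(q < d0) _]/(app0 (K j) psi p b c).
  rewrite [in LHS](IH j (vnext j)) mulr_sumr.
  by apply: eq_bigr => l _; rewrite mulrA.
- case=> KE vnext psi a b c.
  rewrite -[LHS](kraus_resolution (fun q => psi a q c) b KE).
  rewrite (@sum_tagged _ _ _ (fun j l =>
    app1 (adj (K j)) (outcome_vec l) a b c *
    inner (outcome_vec l) (app1 (K j) psi))) => [|j l]; last first.
    rewrite outcome_vec_Meas1.
    by rewrite (inner_eql _ (@outcome_vec_Meas1 _ _ _ _ _ K next j l)) inner_app1.
  apply: eq_bigr => j _.
  under [RHS]eq_bigr do rewrite mulr_suml.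
  rewrite [RHS]exchange_big; apply: eq_bigr => p _ /=.
  rewrite -[\sum_(q < d1) _]/(app1 (K j) psi a p c).
  rewrite [in LHS](IH j (vnext j)) mulr_sumr.
  by apply: eq_bigr => l _; rewrite mulrA.
- case=> KE vnext psi a b c.
  rewrite -[LHS](kraus_resolution (fun q => psi a b q) c KE).
  rewrite (@sum_tagged _ _ _ (fun j l =>
    app2 (adj (K j)) (outcome_vec l) a b c *
    inner (outcome_vec l) (app2 (K j) psi))) => [|j l]; last first.
    rewrite outcome_vec_Meas2.
    by rewrite (inner_eql _ (@outcome_vec_Meas2 _ _ _ _ _ K next j l)) inner_app2.
  apply: eq_bigr => j _.
  under [RHS]eq_bigr do rewrite mulr_suml.
  rewrite [RHS]exchange_big; apply: eq_bigr => p _ /=.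
  rewrite -[\sum_(q < d2) _]/(app2 (K j) psi a b p).
  rewrite [in LHS](IH j (vnext j)) mulr_sumr.
  by apply: eq_bigr => l _; rewrite mulrA.
Qed.

(** At a leaf, a wrong guess forces the arriving state to vanish; adjointness carries the zero
    amplitude back to the root. *)
Lemma locc_measurement_correct d0 d1 d2 (P : locc C d0 d1 d2) psi i :
  correct P psi i -> forall l : outcome (locc_measurement P),
  outcome_guess l <> i -> inner (outcome_vec l) psi = 0.
Proof.
elim: P psi => {d0 d1 d2} [d0 d1 d2 g|d0 d1 d2 m n K next IH
  |d0 d1 d2 m n K next IH|d0 d1 d2 m n K next IH] psi /=.
- by case=> [psi0|->] // [[a b] c] _; rewrite basis_measurement_inner.
- move=> corr [j l] /= Ng.
  by rewrite (inner_eql _ (@outcome_vec_Meas0 _ _ _ _ _ K next j l)) inner_app0 IH.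
- move=> corr [j l] /= Ng.
  by rewrite (inner_eql _ (@outcome_vec_Meas1 _ _ _ _ _ K next j l)) inner_app1 IH.
- move=> corr [j l] /= Ng.
  by rewrite (inner_eql _ (@outcome_vec_Meas2 _ _ _ _ _ K next j l)) inner_app2 IH.
Qed.

End ProductMeasurement.

(** * The space S_5 and its product vectors *)

Section S5.
Variable C : numClosedFieldType.
Implicit Types (t x : tensor C 2 2 2) (phi : 'I_5 -> tensor C 2 2 2).

Local Notation o0 := (ord0 : 'I_2).
Local Notation o1 := (ord_max : 'I_2).

Lemma sum2 (F : 'I_2 -> C) : \sum_(a < 2) F a = F o0 + F o1.
Proof.
by rewrite big_ord_recr big_ord1 /=; congr (F _ + _); apply: val_inj.
Qed.

Definition gen5_ord k (lt_k5 : (k < 5)%N) := gen5 C (Ordinal lt_k5).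

Lemma inner_gen5 t :
  [/\ inner (@gen5_ord 0 isT) t = t o0 o0 o0,
      inner (@gen5_ord 1 isT) t = t o0 o0 o1 - t o1 o0 o0,
      inner (@gen5_ord 2 isT) t = t o1 o1 o0 - t o0 o1 o1,
      inner (@gen5_ord 3 isT) t = t o0 o0 o1 + t o0 o1 o0 + t o1 o0 o0 &
      inner (@gen5_ord 4 isT) t = t o1 o1 o0 + t o1 o0 o1 + t o0 o1 o1].
Proof.
by split; rewrite /inner !sum2 /gen5_ord /gen5 /ket /= ?(rmorphB, rmorphD) /=
  ?(rmorph0, rmorph1); ring.
Qed.

(** These express orthogonality to |111>, |001> - 2|010> + |100> and |110> - 2|101> + |011>, which
    span the orthogonal complement of S_5. *)
Lemma inS5_eqs t : inS5 t ->
  [/\ t o1 o1 o1 = 0, t o0 o0 o1 + t o1 o0 o0 = 2 * t o0 o1 o0 &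
      t o1 o1 o0 + t o0 o1 o1 = 2 * t o1 o0 o1].
Proof.
by case=> w Ew; split; rewrite !Ew !big_ord_recl !big_ord0 /gen5 /ket /=; ring.
Qed.

(** The projection of [x] on S_5 is <phi_i|x> phi_i; pairing with generators turns this into
    relations between explicit coordinates. *)
Lemma onb_inner_gen5 phi i x l :
  onb_S5 phi -> (forall k, k != i -> inner (phi k) x = 0) ->
  inner (gen5 C l) x = inner (gen5 C l) (phi i) * inner (phi i) x.
Proof.
case=> _ orth span xE; have [w Ew] := span l.
have lin v : inner (gen5 C l) v = \sum_(k < 5) (w k)^* * inner (phi k) v.
  rewrite inner_conj (inner_sumr _ Ew) rmorph_sum.
  by apply: eq_bigr => k _; rewrite rmorphM /= -inner_conj.
rewrite !lin (bigD1 i) //= big1 ?addr0 => [|k /xE ->]; last by rewrite mulr0.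
rewrite (bigD1 i) //= orth eqxx mulr1 big1 ?addr0 // => k /negPf Nk.
by rewrite orth Nk mulr0.
Qed.

(* In S_5, being a product with respect to the middle qubit is a linear
   condition once the ratio -E / D of its coordinates is known. *)
Lemma inS5_middle_product t (D E : C) : inS5 t ->
  D = t o0 o0 o1 - t o1 o0 o0 ->
  (forall a c, D * t a o1 c + E * t a o0 c = 0) ->
  t o0 o0 o0 * t o1 o0 o1 = t o0 o0 o1 * t o1 o0 o0 -> D = 0.
Proof.
case/inS5_eqs=> t111 t1 t2 DE lin minor; apply/eqP/negPn/negP => D0.
have two0 : 2 != 0 :> C by rewrite pnatr_eq0.
have Et101 : E * t o1 o0 o1 = 0 by rewrite -(lin o1 o1) t111 mulr0 add0r.
(* Half the sum of [lin] at (1,0) and (0,1), by the equations of S_5. *)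
have Et010 : D * t o1 o0 o1 + E * t o0 o1 o0 = 0.
  apply: (mulfI two0); rewrite mulr0 mulrDr [2 * (D * _)]mulrCA -t2.
  rewrite [2 * (E * _)]mulrCA -t1.
  rewrite -[RHS]addr0 -{1}(lin o1 o0) -(lin o0 o1); ring.
have t101 : t o1 o0 o1 = 0.
  move/eqP: Et101; rewrite mulf_eq0 => /orP[/eqP E0|/eqP //].
  by move/eqP: Et010; rewrite E0 mul0r addr0 mulf_eq0 (negPf D0) => /eqP.
have t010 : t o0 o1 o0 = 0.
  move/eqP: Et010; rewrite t101 mulr0 add0r mulf_eq0 => /orP[]/eqP // E0.
  have /eqP := lin o0 o0; rewrite E0 mul0r addr0 mulf_eq0 (negPf D0).
  by move/eqP.
have t100 : t o1 o0 o0 = - t o0 o0 o1.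
  by apply/eqP; rewrite -addr_eq0 addrC t1 t010 mulr0.
(* The minor now reads t001^2 = 0, while [D] is 2 t001. *)
have /esym/eqP := minor.
rewrite t101 mulr0 t100 mulrN oppr_eq0 mulf_eq0 orbb => /eqP t001.
by move: D0; rewrite DE t100 t001 oppr0 subr0 eqxx.
Qed.

(** If [D] <> 0, comparing the state with a single outcome vector on the coordinates of middle index
    0 already gives the minor that [inS5_middle_product] asks for. *)
Lemma locc_onb_orthogonal phi (P : locc C 2 2 2) :
  onb_S5 phi -> valid P -> (forall i : 'I_5, correct P (phi i) i) ->
  forall i, inner (@gen5_ord 1 isT) (phi i) = 0.
Proof.
move=> onb vP corr i; have [inS orth _] := onb.
set t := phi i; set D := inner _ t; set E := inner (@gen5_ord 2 isT) t.
apply/eqP/negPn/negP => D0.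
pose x := @outcome_vec C 2 2 2 (locc_measurement P).
(* An outcome that overlaps [t] must guess [i], so it is orthogonal to the other basis states. *)
have xE l k (lt_k5 : (k < 5)%N) : inner (x l) t != 0 ->
    inner (gen5_ord lt_k5) (x l) = inner (gen5_ord lt_k5) t * inner t (x l).
  move=> y0; apply: onb_inner_gen5 => // k' Nk'.
  have gi : outcome_guess l = i.
    apply/eqP; apply: contraNT y0 => /eqP.
    by move/(locc_measurement_correct (corr i)) ->.
  rewrite inner_conj (locc_measurement_correct (corr k')) ?rmorph0 // gi.
  by move/val_inj/eqP; rewrite eq_sym (negPf Nk').
(* If x_l has middle factor (b0, b1), its pairings with |001> - |100> and |110> - |011> are b0 s and
   -b1 s for a common s; they also equal [D] and [E] times <t|x_l>. *)
have xlin l a c : inner (x l) t != 0 -> D * x l a o1 c + E * x l a o0 c = 0.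
  move=> y0; have y0' : inner t (x l) != 0 by rewrite inner_conj conjC_eq0.
  apply: (mulIf y0'); rewrite mul0r mulrDl mulrAC -xE // [E * _ * _]mulrAC -xE //.
  have [_ -> -> _ _] := inner_gen5 (x l).
  by rewrite /x /outcome_vec; ring.
have tE a b c : t a b c = \sum_l x l a b c * inner (x l) t.
  exact: locc_measurement_resolution.
(* [D] and [E] do not depend on [l], so the relation survives summation. *)
have tlin a c : D * t a o1 c + E * t a o0 c = 0.
  rewrite 2!tE !mulr_sumr -big_split big1 //= => l _.
  have [-> | y0] := eqVneq (inner (x l) t) 0; first by rewrite !mulr0 addr0.
  by rewrite [D * _]mulrA [E * _]mulrA -mulrDl xlin ?mul0r.
have [l y0] : exists l, inner (x l) t != 0.
  apply/existsP; rewrite -[X in is_true X]negbK negb_exists.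
  apply: contra D0 => /forallP y0; rewrite /D.
  have t0 a b c : t a b c = 0.
    by rewrite tE big1 // => l _; move/negPn/eqP: (y0 l) => ->; rewrite mulr0.
  by have [_ -> _ _ _] := inner_gen5 t; rewrite !t0 subr0.
set y := inner t (x l); have y0' : y != 0 by rewrite /y inner_conj conjC_eq0.
(* The component of x_l orthogonal to S_5: its pairings with the generators vanish. *)
pose r a b c := x l a b c - t a b c * y.
have rlin a c : D * r a o1 c + E * r a o0 c = 0.
  transitivity ((D * x l a o1 c + E * x l a o0 c)
                - (D * t a o1 c + E * t a o0 c) * y); first by rewrite /r; ring.
  by rewrite xlin // tlin mul0r subr0.
have [g0 g1 _ g3 g4] := inner_gen5 (x l).
have [h0 h1 _ h3 h4] := inner_gen5 t.
have r000 : r o0 o0 o0 = 0 by rewrite /r -g0 -h0 xE // subrr.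
have Dr1 a c : r a o0 c = 0 -> r a o1 c = 0.
  move=> ra; apply/eqP; have /eqP := rlin a c.
  by rewrite ra mulr0 addr0 mulf_eq0 (negPf D0).
have r1 : r o0 o0 o1 = r o1 o0 o0.
  apply/eqP; rewrite -subr_eq0.
  have -> : r o0 o0 o1 - r o1 o0 o0 =
    (x l o0 o0 o1 - x l o1 o0 o0) - (t o0 o0 o1 - t o1 o0 o0) * y
    by rewrite /r; ring.
  by rewrite -g1 -h1 xE // subrr.
have r3 : r o0 o0 o1 + r o0 o1 o0 + r o1 o0 o0 = 0.
  have -> : r o0 o0 o1 + r o0 o1 o0 + r o1 o0 o0 =
    (x l o0 o0 o1 + x l o0 o1 o0 + x l o1 o0 o0)
    - (t o0 o0 o1 + t o0 o1 o0 + t o1 o0 o0) * y by rewrite /r; ring.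
  by rewrite -g3 -h3 xE // subrr.
have r4 : r o1 o1 o0 + r o1 o0 o1 + r o0 o1 o1 = 0.
  have -> : r o1 o1 o0 + r o1 o0 o1 + r o0 o1 o1 =
    (x l o1 o1 o0 + x l o1 o0 o1 + x l o0 o1 o1)
    - (t o1 o1 o0 + t o1 o0 o1 + t o0 o1 o1) * y by rewrite /r; ring.
  by rewrite -g4 -h4 xE // subrr.
(* r010 vanishes with r000, and r100 = r001, so [r3] reduces to 2 r001 = 0. *)
have r001 : r o0 o0 o1 = 0.
  move: r3; rewrite (Dr1 _ _ r000) addr0 -r1 -mulr2n => /eqP.
  by rewrite mulrn_eq0 => /eqP.
have r100 : r o1 o0 o0 = 0 by rewrite -r1.
have r101 : r o1 o0 o1 = 0 by rewrite -r4 (Dr1 _ _ r001) (Dr1 _ _ r100) add0r addr0.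
have xt a b c : r a b c = 0 -> x l a b c = t a b c * y by move/eqP; rewrite subr_eq0 => /eqP.
suff minor : t o0 o0 o0 * t o1 o0 o1 = t o0 o0 o1 * t o1 o0 o0.
  by move/eqP: D0; apply; exact: inS5_middle_product (inS i) h1 tlin minor.
(* Two factors [y] turn the entries of [t] into entries of x_l, whose minor vanishes because x_l is
   a product. *)
apply: (mulIf y0'); apply: (mulIf y0').
transitivity (x l o0 o0 o0 * x l o1 o0 o1); first by rewrite !xt //; ring.
transitivity (x l o0 o0 o1 * x l o1 o0 o0); last by rewrite !xt //; ring.
by rewrite /x /outcome_vec; ring.
Qed.

End S5.

Theorem theorem7 (C : numClosedFieldType) (phi : 'I_5 -> tensor C 2 2 2) :
  onb_S5 phi -> ~ locc_perfectly_distinguishable phi.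
Proof.
move=> onb [P [vP corr]]; have orth1 := locc_onb_orthogonal onb vP corr.
have [_ _ /(_ (Ordinal (isT : (1 < 5)%N))) [w Ew]] := onb.
(* The squared norm of |001> - |100> is 2 in coordinates, but 0 by expansion in [phi]. *)
have [_ E1 _ _ _] := inner_gen5 (gen5_ord C (isT : (1 < 5)%N)).
move: E1; rewrite (inner_sumr _ Ew) big1 => [|i _]; last by rewrite orth1 mulr0.
rewrite /gen5_ord /gen5 /ket /= subr0 sub0r opprK => /esym/eqP.
by rewrite -mulr2n pnatr_eq0.
Qed.
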